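(* For any $\nu\ge0$ and any $v_0\in V_h$, the projected ODE $\frac{dv}{dt}=-P_hQ(v,v)-\nu\Delta_hv$, $v(0)=v_0$, has a unique global solution $v\in C^1([0,\infty);V_h)$. It satisfies the energy equality $\frac{dE^{\rm kin}}{dt}=-\nu\|\tilde D_1v\|_{M_2}^2\le0$, where $E^{\rm kin}=\frac12\langle v,v\rangle_1$; consequently $E^{\rm kin}(t)\le E^{\rm kin}(0)$ and $\nu\int_0^T\|\tilde D_1v\|_{M_2}^2dt\le E^{\rm kin}(0)$ for all $T>0$.
   Context: On a fixed mesh, $C^k(\mathcal K^* )$ are the (finite-dimensional) dual $k$-cochain spaces; $\tilde D_1:C^1\to C^2$ is the dual coboundary matrix and $D_2$ the primal coboundary from faces to cells, with $D_2\tilde D_1^T=0$. $M_1,M_2$ are positive diagonal Hodge-star matrices, $\langle v,w\rangle_1=v^TM_1w$, $\|\omega\|_{M_2}^2=\omega^TM_2\omega$. $V_h=\ker(D_2M_1)$ and $P_h$ is the $M_1$-orthogonal projection onto $V_h$. $\Delta_h=M_1^{-1}\tilde D_1^TM_2\tilde D_1$. $v\mapsto\tilde U(v)$ is linear with values in matrices of the shape of $\tilde D_1^T$, and $Q$ is the bilinear map $M_1Q(v_1,v_2)=\frac12(\tilde U(v_1)\tilde D_1v_2-\tilde D_1^T\tilde U(v_1)^Tv_2)$. *)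

(* Defs.v *)
From HB Require Import structures.
From mathcomp Require Import all_boot all_order all_algebra.
From mathcomp Require Import all_classical all_reals all_analysis.
Set Implicit Arguments. Unset Strict Implicit. Unset Printing Implicit Defensive.
Import Order.TTheory GRing.Theory Num.Theory.
Import numFieldNormedType.Exports.
Local Open Scope classical_set_scope.
Local Open Scope ring_scope.

(* <v,w>_M = v^T M w  (for M = M1 this is <.,.>_1; for M = M2 it gives ||.||_{M2}^2) *)
Definition mip {R : realType} {n : nat} (M : 'M[R]_n) (v w : 'cV[R]_n) : R :=
  (v^T *m M *m w) 0 0.

(* positive diagonal matrix (Hodge star) *)
Definition pos_diag {R : realType} {n : nat} (M : 'M[R]_n) : Prop :=
  is_diag_mx M /\ forall i, 0 < M i i.

Definition in_Vh {R : realType} {n1 n3 : nat} (D2 : 'M[R]_(n3, n1)) (M1 : 'M[R]_n1)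
  (v : 'cV[R]_n1) : Prop := D2 *m M1 *m v = 0.

Definition is_M1_proj {R : realType} {n1 n3 : nat} (D2 : 'M[R]_(n3, n1))
  (M1 : 'M[R]_n1) (P : 'cV[R]_n1 -> 'cV[R]_n1) : Prop :=
  forall v, in_Vh D2 M1 (P v) /\
            forall w, in_Vh D2 M1 w -> mip M1 (v - P v) w = 0.

Definition Delta_h {R : realType} {n1 n2 : nat} (D1 : 'M[R]_(n2, n1))
  (M1 : 'M[R]_n1) (M2 : 'M[R]_n2) : 'M[R]_n1 :=
  invmx M1 *m D1^T *m M2 *m D1.

Definition Qh {R : realType} {n1 n2 : nat} (D1 : 'M[R]_(n2, n1)) (M1 : 'M[R]_n1)
  (U : 'cV[R]_n1 -> 'M[R]_(n1, n2)) (v1 v2 : 'cV[R]_n1) : 'cV[R]_n1 :=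
  invmx M1 *m ((2 : R)^-1 *: (U v1 *m D1 *m v2 - D1^T *m (U v1)^T *m v2)).

Definition has_deriv_Ici {R : realType} {V : normedModType R}
  (f : R -> V) (df : R -> V) : Prop :=
  (forall t : R, 0 < t -> is_derive t 1 f (df t)) /\
  ((fun h : R => h^-1 *: (f h - f 0)) @ 0^'+ --> df 0).

Definition is_C1_sol {R : realType} {n1 n3 : nat} (D2 : 'M[R]_(n3, n1))
  (M1 : 'M[R]_n1) (F : 'cV[R]_n1 -> 'cV[R]_n1) (v0 : 'cV[R]_n1)
  (v : R -> 'cV[R]_n1) : Prop :=
  [/\ v 0 = v0,
      (forall t : R, 0 <= t -> in_Vh D2 M1 (v t)),
      {within `[0, +oo[, continuous v},
      has_deriv_Ici v (fun t => F (v t)) &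
      {within `[0, +oo[, continuous (fun t => F (v t))}].

Definition Ekin {R : realType} {n1 : nat} (M1 : 'M[R]_n1) (v : R -> 'cV[R]_n1)
  (t : R) : R := (2 : R)^-1 * mip M1 (v t) (v t).

(* Main.v *)
Require Import Defs.
From HB Require Import structures.
From mathcomp Require Import all_boot all_order all_algebra.
From mathcomp Require Import all_classical all_reals all_analysis.
From mathcomp Require Import ring lra.
Import Order.TTheory GRing.Theory Num.Theory.
Import numFieldNormedType.Exports.
Local Open Scope classical_set_scope.
Local Open Scope ring_scope.

(* The field [F] is quadratic, hence Lipschitz on balls, takes values in [V_h]
   (because [D2 *m D1^T = 0]), and dissipates the energy: [P] is self-adjoint for
   the [M1] product, [Q(v, .)] is skew, and [Delta_h] contributes the
   [M2]-norm of [D1 *m v]. Composing [F] with a radial retraction gives a globally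
   Lipschitz field, whose flow exists for all times by Picard iteration; the
   energy bound keeps this flow in the ball where nothing was truncated.
   Uniqueness is Gronwall's inequality for the energy of the difference, and the
   integral bound is the fundamental theorem of calculus applied to the energy. *)

(** * Sup norm and coordinatewise differentiation of column vectors *)

Lemma cV_norm_coord (R : realType) (n : nat) (x : 'cV[R]_n) (i : 'I_n) :
  `|x i 0| <= `|x|.
Proof.
rewrite [leRHS]/Num.Def.normr/= mx_normrE.
exact: (le_bigmax _ (fun ij : 'I_n * 'I_1 => `|x ij.1 ij.2|) (i, 0)).
Qed.

Lemma cV_norm_le (R : realType) (n : nat) (x : 'cV[R]_n) (e : R) :
  0 <= e -> (forall i, `|x i 0| <= e) -> `|x| <= e.
Proof.
move=> e0 xe; rewrite /Num.Def.normr/= mx_normrE (bigmax_le _ e0)//= => -[i j] _ /=.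
by rewrite (ord1 j).
Qed.

Lemma is_derive_cV (R : realType) (n : nat) (u : R -> 'cV[R]_n) (t : R)
    (d : 'cV[R]_n) :
  (forall i, is_derive t 1 (fun s => u s i 0) (d i 0)) -> is_derive t 1 u d.
Proof.
move=> ud; have du : derivable u t 1.
  by apply/derivable_mxP => i j; rewrite (ord1 j); have [] := ud i.
split=> //; rewrite derive_mx//; apply/matrixP => i j; rewrite mxE (ord1 j).
by have [] := ud i.
Qed.

Lemma is_derive_coord (R : realType) (n : nat) (u : R -> 'cV[R]_n) (t : R)
    (d : 'cV[R]_n) (i : 'I_n) :
  is_derive t 1 u d -> is_derive t 1 (fun s => u s i 0) (d i 0).
Proof.
move=> [du <-]; split; first by move/derivable_mxP: du; apply.
by rewrite derive_mx// mxE.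
Qed.

Lemma is_derive_continuous (R : realType) (V : normedModType R) (u : R -> V)
    (t : R) (d : V) : is_derive t 1 u d -> {for t, continuous u}.
Proof. by move=> [du _]; exact/differentiable_continuous/derivable1_diffP. Qed.

(** * Monotonicity, mean value inequality and antiderivatives on the half-line *)

Lemma derive_le0_nonincreasing (R : realType) (f df : R -> R) (T : R) : 0 <= T ->
  {within `[0, T], continuous f} ->
  (forall t : R, 0 < t < T -> is_derive t 1 f (df t)) ->
  (forall t : R, 0 < t < T -> df t <= 0) -> f T <= f 0.
Proof.
move=> T0 cf fd df0.
apply: (@ler0_derive1_le_cc R f 0 T) => //; rewrite ?in_itv/= ?lexx ?T0//.
- by move=> x; rewrite in_itv/= => /fd[].
- by move=> x; rewrite in_itv/= => h; rewrite derive1E; have [_ ->] := fd _ h; exact: df0.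
Qed.

(** Each coordinate of [f], taken with either sign, has [phi] as a majorant of its growth: the
    difference has nonpositive derivative. The sup norm then reassembles the coordinate bounds
    without loss. *)
Lemma derive_mean_value_le (R : realType) (n : nat) (f df : R -> 'cV[R]_n)
    (phi dphi : R -> R) (T : R) : 0 <= T ->
  (forall t : R, 0 <= t -> is_derive t 1 f (df t)) ->
  (forall t : R, 0 <= t -> is_derive t 1 phi (dphi t)) ->
  (forall t : R, 0 <= t -> `|df t| <= dphi t) ->
  `|f T - f 0| <= phi T - phi 0.
Proof.
move=> T0 fd phid le_df.
have mono (g dg : R -> R) : (forall t : R, 0 <= t -> is_derive t 1 g (dg t)) ->
    (forall t : R, 0 <= t -> dg t <= 0) -> g T <= g 0.
  move=> gd dg0; apply: (derive_le0_nonincreasing _ _ dg T T0).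
  - apply: continuous_in_subspaceT => x; rewrite inE/= in_itv/= => /andP[x0 _].
    exact: is_derive_continuous (gd _ x0).
  - by move=> t /andP[/ltW t0 _]; exact: gd.
  - by move=> t /andP[/ltW t0 _]; exact: dg0.
have coord i : `|f T i 0 - f 0 i 0| <= phi T - phi 0.
  have fdi t t0 := is_derive_coord _ _ f t _ i (fd t t0).
  rewrite ler_norml; apply/andP; split.
    have := mono (- (fun s => f s i 0) - phi) (fun t => - df t i 0 - dphi t).
    rewrite !fctE => H.
    suff : - f T i 0 - phi T <= - f 0 i 0 - phi 0 by lra.
    apply: H => t t0; first by have := fdi t t0; have := phid t t0; move=> ? ?; exact: is_deriveB.
    have := le_trans (cV_norm_coord _ _ (df t) i) (le_df t t0).
    by rewrite ler_norml => /andP[]; lra.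
  have := mono ((fun s => f s i 0) - phi) (fun t => df t i 0 - dphi t).
  rewrite !fctE => H.
  suff : f T i 0 - phi T <= f 0 i 0 - phi 0 by lra.
  apply: H => t t0; first by have := fdi t t0; have := phid t t0; move=> ? ?; exact: is_deriveB.
  have := le_trans (cV_norm_coord _ _ (df t) i) (le_df t t0).
  by rewrite ler_norml => /andP[]; lra.
apply: cV_norm_le => [|i]; last by rewrite !mxE.
(* [cV_norm_le] needs a nonnegative bound, which the coordinates cannot supply when [n = 0]; it
   comes from [dphi] dominating a norm. *)
suff : - phi T <= - phi 0 by lra.
apply: (mono (- phi) (fun t => - dphi t)) => t t0.
  by have := phid t t0 => ?; exact: is_deriveN.
by rewrite oppr_le0 (le_trans _ (le_df t t0)).
Qed.

Lemma antiderivative (R : realType) (g : R -> R) :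
  (forall t : R, 0 <= t -> {for t, continuous g}) ->
  exists f : R -> R, forall t : R, 0 <= t -> is_derive t 1 f (g t).
Proof.
(* Freezing [g] at [g 0] on negative times makes it continuous on the whole line. Integrating from
   -1 then puts 0 in the interior, so the derivative at 0 is two-sided. *)
move=> cg; pose h t := g (Num.max 0 t).
have ch : continuous h.
  move=> t; have cm : {for t, continuous (fun s : R => Num.max 0 s)}.
    by apply: continuous_max; [exact: cvg_cst|exact: cvg_id].
  have cgt : {for Num.max 0 t, continuous g} by apply: cg; rewrite le_max lexx.
  exact: continuous_comp cm cgt.
exists (fun x => (\int[lebesgue_measure]_(s in `[-1, x]) h s)%R) => t t0.
have [] := @continuous_FTC1_closed R h (-1) t (t + 1).
- by rewrite ltrDl.
- apply: continuous_compact_integrable; first exact: segment_compact.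
  by apply: continuous_subspaceT.
- lra.
- exact: ch.
- by rewrite derive1E /h max_r// => ? ?; split.
Qed.

Lemma antiderivative_cV (R : realType) (n : nat) (g : R -> 'cV[R]_n)
    (x0 : 'cV[R]_n) :
  (forall t : R, 0 <= t -> {for t, continuous g}) ->
  exists w : R -> 'cV[R]_n, w 0 = x0 /\ forall t : R, 0 <= t -> is_derive t 1 w (g t).
Proof.
move=> cg.
have /choice[f fP] : forall i, exists f : R -> R,
    forall t : R, 0 <= t -> is_derive t 1 f (g t i 0).
  move=> i; apply: (@antiderivative R (fun t => g t i 0)) => t t0.
  by apply: (@continuous_comp _ _ _ g (fun x : 'cV[R]_n => x i 0));
    [exact: cg|exact: coord_continuous].
exists (fun t => \col_i (f i t + (x0 i 0 - f i 0))); split.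
  by apply/colP => i; rewrite mxE addrCA subrr addr0.
move=> t t0; apply: is_derive_cV => i; have := fP i t t0 => fi.
rewrite -[g t i 0]addr0 (_ : (fun _ => _) = f i + cst (x0 i 0 - f i 0)).
  exact: is_deriveD.
by apply/funext => s; rewrite mxE.
Qed.

(** * Limits of geometric sequences and Picard iteration *)

Lemma geometric_increments_limit (R : realType) (a : nat -> R) (c : R) :
  (forall k, `|a k.+1 - a k| <= c / 2 ^+ k) ->
  exists l, forall k, `|l - a k| <= 2 * c / 2 ^+ k.
Proof.
move=> ac.
(* Nested intervals: the radius [2 * c / 2 ^+ k] shrinks by exactly [c / 2 ^+ k] at each step, which
   is the allowed increment. The limit is the supremum of the left endpoints. *)
pose lo k := a k - 2 * c / 2 ^+ k; pose hi k := a k + 2 * c / 2 ^+ k.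
have half k : c / 2 ^+ k.+1 = c / 2 ^+ k / 2.
  by rewrite exprSr invfM mulrA.
have loS k : lo k <= lo k.+1.
  have := ac k; rewrite ler_norml /lo -!mulrA half => /andP[]; lra.
have hiS k : hi k.+1 <= hi k.
  have := ac k; rewrite ler_norml /hi -!mulrA half => /andP[]; lra.
have lohi k : lo k <= hi k.
  have := le_trans (normr_ge0 _) (ac k); rewrite /lo /hi -!mulrA; lra.
have lo_mono : {homo lo : i j / (i <= j)%N >-> i <= j}.
  by apply: homo_leq => //; exact: le_trans.
have hi_mono : {homo hi : i j / (i <= j)%N >-> j <= i}.
  by apply: homo_leq => // x y z; exact: ge_trans.
have lohi2 j k : lo j <= hi k.
  apply: (le_trans (lo_mono _ _ (leq_maxl j k))).
  by apply: (le_trans (lohi _)); apply: hi_mono; exact: leq_maxr.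
have slo : has_sup (range lo).
  split; first by exists (lo 0%N), 0%N.
  by exists (hi 0%N) => _ [j _ <-].
exists (sup (range lo)) => k.
have h1 : lo k <= sup (range lo) by apply: ub_le_sup; [case: slo|exists k].
have h2 : sup (range lo) <= hi k.
  by apply: ge_sup => [|_ [j _ <-]//]; case: slo.
by move: h1 h2; rewrite /lo /hi ler_norml => ? ?; apply/andP; split; lra.
Qed.

Lemma geometric_increments_limit_cV (R : realType) (n : nat)
    (a : nat -> 'cV[R]_n) (c : R) : 
  (forall k, `|a k.+1 - a k| <= c / 2 ^+ k) ->
  exists l, forall k, `|l - a k| <= 2 * c / 2 ^+ k.
Proof.
move=> ac; have /choice[l lP] : forall i, exists l, 
    forall k, `|l - a k i 0| <= 2 * c / 2 ^+ k.
  move=> i; apply: (@geometric_increments_limit R (fun k => a k i 0)) => k.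
  apply: le_trans (ac k).
  by have := cV_norm_coord _ _ (a k.+1 - a k) i; rewrite !mxE.
exists (\col_i l i) => k; apply: cV_norm_le => [|i]; last by rewrite !mxE.
have := le_trans (normr_ge0 _) (ac k); rewrite -mulrA; lra.
Qed.

Lemma lipschitz_near_continuous (R : realType) (V W : normedModType R)
    (G : V -> W) (L : R) (x : V) : 0 < L ->
  (forall y, `|x - y| <= 1 -> `|G x - G y| <= L * `|x - y|) ->
  {for x, continuous G}.
Proof.
move=> L0 GL; apply/cvgrPdist_le => e e0; near=> y.
apply: (le_trans (GL _ _)).
  by near: y; apply: cvgr_dist_le; [exact: cvg_id|].
rewrite mulrC -ler_pdivlMr//.
by near: y; apply: cvgr_dist_le; [exact: cvg_id|exact: divr_gt0].
Unshelve. all: by end_near. Qed.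

Lemma is_derive_expR_scaled (R : realType) (c m t : R) :
  is_derive t 1 (fun s => c * expR (m * s)) (m * (c * expR (m * t))).
Proof.
have dm : is_derive t 1 ( *%R m) m.
  rewrite -[X in is_derive _ _ _ X]mulr1.
  exact: (@is_deriveZ _ _ _ id m t 1 1 (is_derive_id _ _)).
have de := @is_derive1_comp R expR ( *%R m) t _ _ (is_derive_expR _) dm.
rewrite (_ : m * _ = c *: (expR (m * t) * m)); last by rewrite /GRing.scale/=; ring.
exact: (is_deriveZ c de).
Qed.

Lemma small_multiples_eq0 (R : realType) (x c : R) : 0 <= x ->
  (forall k : nat, x <= c / 2 ^+ k) -> x = 0.
Proof.
move=> x0 xc; apply/eqP; rewrite eq_le x0 andbT.
apply: (@closed_cvg _ _ \oo _ (fun k => c / 2 ^+ k) (fun y => x <= y)).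
- exact: closed_ge.
- exact: nearW.
- rewrite (_ : (fun k : nat => c / 2 ^+ k) = geometric c 2^-1).
    by apply: cvg_geometric; rewrite ger0_norm ?invf_lt1 ?ltr1n.
  by apply/funext => k; rewrite /geometric/= exprVn.
Qed.

(* Weighting by [expR (2 * L * t)] makes the Picard map a contraction of ratio
   1/2 on the whole half-line, so no continuation argument is needed. *)
Lemma lipschitz_ode_global_solution (R : realType) (n : nat)
    (G : 'cV[R]_n -> 'cV[R]_n) (L : R) (x0 : 'cV[R]_n) : 0 < L ->
  (forall x y, `|G x - G y| <= L * `|x - y|) ->
  exists w : R -> 'cV[R]_n,
    w 0 = x0 /\ forall t : R, 0 <= t -> is_derive t 1 w (G (w t)).
Proof.
move=> L0 GL; have cG : continuous G.
  by move=> x; apply: (lipschitz_near_continuous _ _ _ G L) => // y _.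
pose cont_ge0 (u : R -> 'cV[R]_n) := forall t : R, 0 <= t -> {for t, continuous u}.
have cGcomp u : cont_ge0 u -> forall t : R, 0 <= t -> {for t, continuous (G \o u)}.
  by move=> cu t t0; apply: continuous_comp; [exact: cu|exact: cG].
(* The Picard map, made total: on a [u] that is not continuous on the half-line its value is a
   dummy, and all iterates from the constant [x0] avoid that case. *)
have /choice[step stepP] : forall u, exists w, cont_ge0 u ->
    w 0 = x0 /\ forall t : R, 0 <= t -> is_derive t 1 w (G (u t)).
  move=> u; have [cu|ncu] := pselect (cont_ge0 u); last by exists u.
  have [w wP] := antiderivative_cV _ _ (G \o u) x0 (cGcomp u cu).
  by exists w.
pose u k := iter k step (cst x0).
have cu k : cont_ge0 (u k).
  elim: k => [t _|k IH t t0]; first exact: cst_continuous.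
  by have [_ /(_ t t0)] := stepP _ IH; exact: is_derive_continuous.
have u0 k : u k 0 = x0 by case: k => // k; have [] := stepP _ (cu k).
have du k (t : R) : 0 <= t -> is_derive t 1 (u k.+1) (G (u k t)).
  by have [_] := stepP _ (cu k); apply.
(* Chosen so that the derivative [2 * L * (C * e t)] of the majorant equals [|G x0|] at time 0 and
   exceeds it later, which bounds the first Picard step. *)
pose C := `|G x0| / (2 * L).
have C0 : 0 <= C by rewrite divr_ge0// mulr_ge0// ltW.
pose e (t : R) := expR (2 * L * t).
have e1 t : 0 <= C * e t by rewrite mulr_ge0// expR_ge0.
have half k (c : R) : c / 2 ^+ k.+1 = c / 2 ^+ k / 2.
  by rewrite exprSr invfM mulrA.
(* The Lipschitz constant contributes [L] and the integration of [e] contributes [1 / (2 * L)],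
   hence a factor 1/2 per iteration. *)
have duS k (t : R) : 0 <= t -> `|u k.+1 t - u k t| <= C * e t / 2 ^+ k.
  elim: k t => [|k IH] t t0.
    have := derive_mean_value_le _ _ (u 1%N) (fun=> G x0) (fun s => C * e s)
      (fun s => 2 * L * (C * e s)) t t0 (du 0%N)
      (fun s _ => is_derive_expR_scaled _ C (2 * L) s).
    rewrite u0 expr0 divr1 => H; apply: (le_trans (H _)); last first.
      by rewrite gerBl.
    move=> s s0; rewrite /C mulrA mulrCA divff ?mulr1; last by rewrite mulf_neq0// gt_eqF.
    rewrite ler_peMr// -expR0 ler_expR.
    by apply: mulr_ge0 => //; apply: mulr_ge0 => //; exact: ltW.
  pose ck := C / 2 ^+ k.+1.
  have := derive_mean_value_le _ _ (u k.+2 - u k.+1)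
    (fun s => G (u k.+1 s) - G (u k s)) (fun s => ck * e s)
    (fun s => 2 * L * (ck * e s)) t t0.
  rewrite !fctE !u0 subrr subr0 => H; apply: (le_trans (H _ _ _)) => [s s0|s _|s s0|].
  - by have := du k s s0; have := du k.+1 s s0 => ? ?; exact: is_deriveB.
  - exact: is_derive_expR_scaled.
  - apply: (le_trans (GL _ _)).
    apply: (le_trans (ler_wpM2l (ltW L0) (IH s s0))).
    by rewrite /ck half le_eqVlt; apply/orP; left; apply/eqP; field; rewrite expf_neq0.
  - by rewrite mulrAC gerBl mulr_ge0 ?expR_ge0// divr_ge0// exprn_ge0.
(* The increments are controlled at nonnegative times only, so time is clamped by [Num.max 0] to
   define the limit everywhere. *)
have /choice[v vP] : forall t : R, exists l, forall k,
    `|l - u k (Num.max 0 t)| <= 2 * (C * e (Num.max 0 t)) / 2 ^+ k.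
  move=> t; apply: geometric_increments_limit_cV => k.
  by apply: duS; rewrite le_max lexx.
have vu k (t : R) : 0 <= t -> `|v t - u k t| <= 2 * (C * e t) / 2 ^+ k.
  by move=> t0; have := vP t k; rewrite max_r.
have cv : cont_ge0 v.
  move=> t t0; apply/cvgrPdist_le => eps eps0.
  (* Three-epsilon argument: since [e] is increasing, one [k] serves all times up to [t + 1], and
     continuity of [u k] does the rest. *)
  have [k kP] : exists k : nat, 2 * (C * e (t + 1)) / 2 ^+ k <= eps / 3.
    apply: contrapT => /forallNP H; have : eps / 3 = 0 by
      apply: (@small_multiples_eq0 _ _ (2 * (C * e (t + 1)))) => [|k];
      [rewrite divr_ge0// ltW|apply: ltW; rewrite ltNge; apply/negP; exact: H].
    by move/eqP; rewrite mulf_eq0 invr_eq0 pnatr_eq0 orbF gt_eqF.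
  have cm : {for t, continuous (fun s : R => Num.max 0 s)}.
    by apply: continuous_max; [exact: cvg_cst|exact: cvg_id].
  have cuk : {for Num.max 0 t, continuous (u k)} by apply: cu; rewrite le_max lexx.
  have /cvgrPdist_le cum := continuous_comp cm cuk.
  have bd (s : R) : Num.max 0 s <= t + 1 -> `|v s - u k (Num.max 0 s)| <= eps / 3.
    move=> st; apply: (le_trans (vP s k)); apply: le_trans kP.
    rewrite ler_pM2r ?invr_gt0 ?exprn_gt0// ler_pM2l// ler_wpM2l// ler_expR.
    by rewrite ler_pM2l// mulr_gt0.
  have nt1 : \forall s \near t, s <= t + 1.
    by apply: (@cvgr_le _ _ (nbhs t) _ id t cvg_id); rewrite ltrDl.
  near=> s.
  have h1 := bd t; have h2 := bd s.
  have h3 : `|u k (Num.max 0 t) - u k (Num.max 0 s)| <= eps / 3.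
    by near: s; apply: cum; rewrite divr_gt0.
  rewrite (_ : v t - v s = (v t - u k (Num.max 0 t)) +
      (u k (Num.max 0 t) - u k (Num.max 0 s)) - (v s - u k (Num.max 0 s))); last first.
    by rewrite subrKA opprB subrKA.
  apply: (le_trans (ler_normB _ _)).
  apply: (@le_trans _ _ (eps / 3 + eps / 3 + eps / 3)); last lra.
  apply: lerD; last first.
    apply: h2; rewrite ge_max addr_ge0//=.
    by near: s; exact: nt1.
  apply: (le_trans (ler_normD _ _)); apply: lerD => //.
  by apply: h1; rewrite max_r// lerDl.
(* Instead of differentiating the limit [v], integrate [G (v t)] to get [w]. Both [w] and [v] lie
   within a multiple of [2 ^- k] of [u k.+1], so they agree for [t >= 0] and [w] solves the
   equation. *)
have [w [w0 dw]] := antiderivative_cV _ _ (G \o v) x0 (cGcomp v cv).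
exists w; split=> // t t0; suff -> : w t = v t by exact: dw.
apply/eqP; rewrite -subr_eq0 -normr_eq0; apply/eqP.
apply: (@small_multiples_eq0 _ _ (3 * (C * e t))) => // k.
pose ck := C / 2 ^+ k.
have wu : `|w t - u k.+1 t| <= ck * e t.
  have := derive_mean_value_le _ _ (w - u k.+1)
    (fun s => G (v s) - G (u k s)) (fun s => ck * e s)
    (fun s => 2 * L * (ck * e s)) t t0.
  rewrite !fctE !u0 w0 subrr subr0 => H; apply: (le_trans (H _ _ _)) => [s s0|s _|s s0|].
  - by have := du k s s0; have := dw s s0 => ? ?; exact: is_deriveB.
  - exact: is_derive_expR_scaled.
  - apply: (le_trans (GL _ _)).
    apply: (le_trans (ler_wpM2l (ltW L0) (vu k s s0))).
    by rewrite /ck le_eqVlt; apply/orP; left; apply/eqP; field; rewrite expf_neq0.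
  - by rewrite gerBl mulr_ge0 ?expR_ge0// divr_ge0// exprn_ge0.
rewrite (_ : w t - v t = (w t - u k.+1 t) - (v t - u k.+1 t)); last first.
  by rewrite opprB subrKA.
apply: (le_trans (ler_normB _ _)); apply: (le_trans (lerD wu (vu _ _ t0))).
rewrite half /ck; set q := 2 ^+ k; have q0 : 0 <= q^-1 by rewrite invr_ge0 exprn_ge0.
have := mulr_ge0 (e1 t) q0.
by set y := _ / q; rewrite (_ : C / q * e t = y) 1?/y; [|ring]; lra.
Unshelve. all: by end_near. Qed.

(** * Radial retraction onto a ball of the sup norm *)

Definition radial {R : realType} {n : nat} (r : R) (x : 'cV[R]_n) : 'cV[R]_n :=
  (r / Num.max r `|x|) *: x.

Lemma radial_factor_gt0 (R : realType) (n : nat) (r : R) (x : 'cV[R]_n) :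
  0 < r -> 0 < r / Num.max r `|x|.
Proof. by move=> r0; rewrite divr_gt0// lt_max r0. Qed.

Lemma radial_norm (R : realType) (n : nat) (r : R) (x : 'cV[R]_n) :
  0 < r -> `|radial r x| <= r.
Proof.
move=> r0; rewrite normrZ gtr0_norm ?radial_factor_gt0//.
have m0 : 0 < Num.max r `|x| by rewrite lt_max r0.
by rewrite mulrAC ler_pdivrMr// ler_pM2l// le_max lexx orbT.
Qed.

Lemma radial_id (R : realType) (n : nat) (r : R) (x : 'cV[R]_n) :
  0 < r -> `|x| <= r -> radial r x = x.
Proof. by move=> r0 xr; rewrite /radial max_l// divff ?gt_eqF// scale1r. Qed.

Lemma radial_lipschitz (R : realType) (n : nat) (r : R) (x y : 'cV[R]_n) :
  0 < r -> `|radial r x - radial r y| <= 2 * `|x - y|.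
Proof.
move=> r0; rewrite /radial.
set a := Num.max r `|x|; set b := Num.max r `|y|.
have a0 : 0 < a by rewrite lt_max r0.
have b0 : 0 < b by rewrite lt_max r0.
have ra : r <= a by rewrite le_max lexx.
have yb : `|y| <= b by rewrite le_max lexx orbT.
have ab : `|b - a| <= `|x - y|.
  have := ler_dist_dist x y; rewrite /a /b !ler_norml => /andP[h1 h2].
  by case: (leP r `|x|) => hx; case: (leP r `|y|) => hy; apply/andP; split; lra.
(* The constant 2 counts two terms, each at most [|x - y|]: the first because [r <= a], the second
   because [|y| <= b] and [Num.max r] is 1-Lipschitz. *)
rewrite (_ : _ - _ = (r / a) *: (x - y) + (r / a - r / b) *: y); last first.
  by rewrite scalerBr scalerBl addrA subrK.
apply: (le_trans (ler_normD _ _)); rewrite [X in X + _]normrZ [X in _ + X]normrZ.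
have ra0 : 0 <= r / a by rewrite divr_ge0 ?ltW.
have ra1 : r / a <= 1 by rewrite ler_pdivrMr// mul1r.
have -> : r / a - r / b = r / a * ((b - a) / b).
  by field; rewrite !gt_eqF.
rewrite (ger0_norm ra0) [X in _ + X * _]normrM (ger0_norm ra0) (normrM (b - a)) (gtr0_norm (_ : 0 < b^-1)) ?invr_gt0//.
have h1 : r / a * `|x - y| <= `|x - y| by rewrite ler_piMl.
suff h2 : r / a * (`|b - a| / b) * `|y| <= `|x - y| by lra.
rewrite -!mulrA mulrA -[leRHS]mul1r; apply: ler_pM => //.
  by rewrite !mulr_ge0// invr_ge0 ltW.
rewrite -[leRHS]mulr1; apply: ler_pM => //.
  by rewrite mulr_ge0// invr_ge0 ltW.
by rewrite mulrC ler_pdivrMr// mul1r.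
Qed.

(** * Bounds for linear, bilinear and quadratic maps in finite dimension *)

Lemma linear_sum_coord (R : realType) (n : nat) (W : lmodType R)
    (f : 'cV[R]_n -> W) :
  (forall (a : R) x y, f (a *: x + y) = a *: f x + f y) ->
  forall x, f x = \sum_(i < n) x i 0 *: f (delta_mx i 0).
Proof.
move=> lf x.
pose fL : {linear 'cV[R]_n -> W} := HB.pack f (GRing.isLinear.Build R _ _ _ f lf).
rewrite {1}[x]matrix_sum_delta -[f]/(fL : _ -> _) linear_sum; apply: eq_bigr => i _.
by rewrite big_ord1 linearZ.
Qed.

Lemma linear_bound (R : realType) (n : nat) (W : normedModType R)
    (f : 'cV[R]_n -> W) :
  (forall (a : R) x y, f (a *: x + y) = a *: f x + f y) ->
  exists C, 0 <= C /\ forall x, `|f x| <= C * `|x|.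
Proof.
move=> lf; exists (\sum_(i < n) `|f (delta_mx i 0)|); split; first exact: sumr_ge0.
move=> x; rewrite (linear_sum_coord _ _ _ f lf x).
apply: (le_trans (ler_norm_sum _ _ _)); rewrite mulr_suml; apply: ler_sum => i _.
by rewrite normrZ mulrC ler_wpM2l// cV_norm_coord.
Qed.

Lemma bilinear_bound (R : realType) (n m : nat) (W : normedModType R)
    (f : 'cV[R]_n -> 'cV[R]_m -> W) :
  (forall (a : R) x x' y, f (a *: x + x') y = a *: f x y + f x' y) ->
  (forall (a : R) x y y', f x (a *: y + y') = a *: f x y + f x y') ->
  exists C, 0 <= C /\ forall x y, `|f x y| <= C * `|x| * `|y|.
Proof.
move=> lf1 lf2.
have /choice[c cP] : forall i : 'I_n, exists c,
    0 <= c /\ forall y, `|f (delta_mx i 0) y| <= c * `|y|.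
  by move=> i; apply: linear_bound => a y y'; exact: lf2.
exists (\sum_i c i); split; first by apply: sumr_ge0 => i _; have [] := cP i.
move=> x y; rewrite (linear_sum_coord _ _ _ (f^~ y) (fun a x x' => lf1 a x x' y) x).
apply: (le_trans (ler_norm_sum _ _ _)); rewrite !mulr_suml; apply: ler_sum => i _.
have [c0 ci] := cP i.
rewrite normrZ [c i * _]mulrC -mulrA; apply: ler_pM => //; exact: cV_norm_coord.
Qed.

(** Polarisation: [B x x - B y y = B (x - y) x + B y (x - y)], and the undifferenced arguments have
    norm at most [r]. *)
Lemma quadratic_lipschitz_on_ball (R : realType) (n : nat) (W : normedModType R)
    (B : 'cV[R]_n -> 'cV[R]_n -> W) (A : 'cV[R]_n -> W) (r : R) : 0 <= r ->
  (forall (a : R) x x' y, B (a *: x + x') y = a *: B x y + B x' y) ->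
  (forall (a : R) x y y', B x (a *: y + y') = a *: B x y + B x y') ->
  (forall (a : R) x y, A (a *: x + y) = a *: A x + A y) ->
  exists K, 0 < K /\ forall x y, `|x| <= r -> `|y| <= r ->
    `|(B x x + A x) - (B y y + A y)| <= K * `|x - y|.
Proof.
move=> r0 B1 B2 lA.
have [c [c0 cP]] := bilinear_bound _ _ _ _ B B1 B2.
have [a [a0 aP]] := linear_bound _ _ _ A lA.
(* The final 1 makes the constant strictly positive even when [B] and [A] vanish. *)
exists (c * r + c * r + a + 1); split.
  by rewrite ltr_wpDl// !addr_ge0// mulr_ge0.
move=> x y xr yr.
have subE (f : 'cV[R]_n -> W) : (forall (a : R) x y, f (a *: x + y) = a *: f x + f y) ->
    f (x - y) = f x - f y.
  by move=> lf; rewrite addrC -scaleN1r lf scaleN1r addrC.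
rewrite (_ : _ - _ = B (x - y) x + B y (x - y) + A (x - y)); last first.
  rewrite (subE A)// (subE (B y))// (subE (B^~ x)); last by move=> *; exact: B1.
  by rewrite subrKA opprD addrACA.
apply: (le_trans (ler_normD _ _)); rewrite 2!mulrDl mul1r.
apply: (@le_trans _ _ ((c * r + c * r) * `|x - y| + a * `|x - y|)); last first.
  by rewrite lerDl.
apply: lerD => //; apply: (le_trans (ler_normD _ _)); rewrite mulrDl; apply: lerD.
  apply: (le_trans (cP _ _)); rewrite -!mulrA ler_wpM2l// mulrC.
  by rewrite ler_wpM2r.
by apply: (le_trans (cP _ _)); rewrite -!mulrA ler_wpM2l// ler_wpM2r.
Qed.

(** * Inner products weighted by positive diagonal matrices *)

Lemma mip_diag (R : realType) (n : nat) (M : 'M[R]_n) (x y : 'cV[R]_n) :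
  is_diag_mx M -> mip M x y = \sum_i M i i * (x i 0 * y i 0).
Proof.
move=> /is_diag_mxP dM; rewrite /mip -mulmxA mxE; apply: eq_bigr => i _.
rewrite !mxE (bigD1 i)//= big1 => [|j ji]; first by rewrite addr0 mulrCA.
by rewrite dM ?mul0r// eq_sym.
Qed.

Lemma mipC (R : realType) (n : nat) (M : 'M[R]_n) (x y : 'cV[R]_n) :
  is_diag_mx M -> mip M x y = mip M y x.
Proof.
by move=> dM; rewrite !mip_diag//; apply: eq_bigr => i _; rewrite [x i 0 * _]mulrC.
Qed.

Lemma mipDl (R : realType) (n : nat) (M : 'M[R]_n) (x y z : 'cV[R]_n) :
  mip M (x + y) z = mip M x z + mip M y z.
Proof. by rewrite /mip raddfD/= !mulmxDl mxE. Qed.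

Lemma mipZl (R : realType) (n : nat) (M : 'M[R]_n) (a : R) (x z : 'cV[R]_n) :
  mip M (a *: x) z = a * mip M x z.
Proof. by rewrite /mip linearZ/= -!scalemxAl mxE. Qed.

Lemma mipNl (R : realType) (n : nat) (M : 'M[R]_n) (x z : 'cV[R]_n) :
  mip M (- x) z = - mip M x z.
Proof. by rewrite -scaleN1r mipZl mulN1r. Qed.

Lemma mipZr (R : realType) (n : nat) (M : 'M[R]_n) (a : R) (x z : 'cV[R]_n) :
  mip M x (a *: z) = a * mip M x z.
Proof. by rewrite /mip -scalemxAr mxE. Qed.

Lemma mipDr (R : realType) (n : nat) (M : 'M[R]_n) (x y z : 'cV[R]_n) :
  mip M x (y + z) = mip M x y + mip M x z.
Proof. by rewrite /mip mulmxDr mxE. Qed.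

Lemma mip_ge0 (R : realType) (n : nat) (M : 'M[R]_n) (x : 'cV[R]_n) :
  pos_diag M -> 0 <= mip M x x.
Proof.
move=> [dM M0]; rewrite mip_diag//; apply: sumr_ge0 => i _.
by rewrite mulr_ge0 ?(ltW (M0 i))// -expr2 sqr_ge0.
Qed.

Lemma mip_coord_le (R : realType) (n : nat) (M : 'M[R]_n) (x : 'cV[R]_n) i :
  pos_diag M -> M i i * (x i 0 * x i 0) <= mip M x x.
Proof.
move=> [dM M0]; rewrite mip_diag// (bigD1 i)//= lerDl; apply: sumr_ge0 => j _.
by rewrite mulr_ge0 ?(ltW (M0 j))// -expr2 sqr_ge0.
Qed.

Lemma mip_eq0 (R : realType) (n : nat) (M : 'M[R]_n) (x : 'cV[R]_n) :
  pos_diag M -> mip M x x <= 0 -> x = 0.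
Proof.
move=> pM x0; apply/colP => i; rewrite mxE; apply/eqP.
have Mi : 0 < M i i by case: pM.
have := le_trans (mip_coord_le _ _ M x i pM) x0.
by rewrite pmulr_rle0// -expr2 => h; rewrite -sqrf_eq0 eq_le h sqr_ge0.
Qed.

(** The square of coordinate [i] is at most [(M i i)^-1 * mip M x x]; the sum of all the inverses
    dominates each of them, so it serves every coordinate at once. *)
Lemma mip_norm_equiv (R : realType) (n : nat) (M : 'M[R]_n) :
  pos_diag M -> exists c, 0 <= c /\ forall x, `|x| ^+ 2 <= c * mip M x x.
Proof.
move=> pM; have M0 i : 0 < M i i by case: pM.
have c0 : 0 <= \sum_i (M i i)^-1 by apply: sumr_ge0 => i _; rewrite invr_ge0 ltW.
exists (\sum_i (M i i)^-1); split=> // x; set c := \sum_i _ in c0 *.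
have cm : 0 <= c * mip M x x by rewrite mulr_ge0// mip_ge0.
rewrite -[leRHS]sqr_sqrtr// ler_sqr ?nnegrE ?sqrtr_ge0//.
apply: cV_norm_le => [|i]; first exact: sqrtr_ge0.
rewrite -sqrtr_sqr ler_wsqrtr// expr2.
apply: (@le_trans _ _ ((M i i)^-1 * mip M x x)).
  by rewrite [leRHS]mulrC ler_pdivlMr// mulrC mip_coord_le.
apply: ler_wpM2r; first exact: mip_ge0.
by rewrite /c (bigD1 i)//= lerDl; apply: sumr_ge0 => j _; rewrite invr_ge0 ltW.
Qed.

Lemma mip_bounded (R : realType) (n : nat) (M : 'M[R]_n) (E : R) :
  pos_diag M -> exists r, 0 < r /\ forall x, mip M x x <= E -> `|x| <= r.
Proof.
move=> pM; have [c [c0 cP]] := mip_norm_equiv _ _ M pM.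
(* No square root is needed: [(|x| - 1)^2 >= 0] gives [|x| <= 1 + |x|^2]. The absolute value of [E]
   keeps the radius positive for negative [E]. *)
exists (1 + c * `|E|); split; first by rewrite ltr_pwDl// mulr_ge0.
move=> x xE; have h : `|x| ^+ 2 <= c * `|E|.
  by apply: (le_trans (cP x)); rewrite ler_wpM2l// (le_trans xE)// ler_norm.
by have := sqr_ge0 (`|x| - 1); nra.
Qed.

Lemma pos_diag_unitmx (R : realType) (n : nat) (M : 'M[R]_n) :
  pos_diag M -> M \in unitmx.
Proof.
move=> [/is_diag_mxP dM M0].
have -> : M = diag_mx (\row_i M i i).
  apply/matrixP => i j; rewrite !mxE; case: eqVneq => [->|ij]; first by rewrite mulr1n.
  by rewrite mulr0n dM.
rewrite unitmxE det_diag unitfE; apply/prodf_neq0 => i _.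
by rewrite mxE gt_eqF.
Qed.

(** * The space [V_h], its projection, and the operators [Qh] and [Delta_h] *)

Lemma in_Vh_linear (R : realType) (n1 n3 : nat) (D2 : 'M[R]_(n3, n1))
    (M1 : 'M[R]_n1) (a : R) (x y : 'cV[R]_n1) :
  in_Vh D2 M1 x -> in_Vh D2 M1 y -> in_Vh D2 M1 (a *: x + y).
Proof. by rewrite /in_Vh mulmxDr -scalemxAr => -> ->; rewrite scaler0 addr0. Qed.

(** Linearity follows from uniqueness of the projection: the defect lies in [V_h] and is a
    combination of residuals orthogonal to [V_h], so it is orthogonal to itself. *)
Lemma M1_proj_linear (R : realType) (n1 n3 : nat) (D2 : 'M[R]_(n3, n1))
    (M1 : 'M[R]_n1) (P : 'cV[R]_n1 -> 'cV[R]_n1) :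
  pos_diag M1 -> is_M1_proj D2 M1 P ->
  forall (a : R) x y, P (a *: x + y) = a *: P x + P y.
Proof.
move=> pM PP a x y.
have Vx w : in_Vh D2 M1 (P w) by have [] := PP w.
set z := a *: x + y; apply/eqP; rewrite -subr_eq0; apply/eqP.
have dV : in_Vh D2 M1 (P z - (a *: P x + P y)).
  rewrite addrC -scaleN1r; apply: in_Vh_linear => //; exact: in_Vh_linear.
apply: (mip_eq0 _ _ M1) => //; set d := P z - _ in dV *.
have dE : d = a *: (x - P x) + (y - P y) - (z - P z).
  by rewrite scalerBr [X in _ = X - _]addrACA -opprD -/z opprB [RHS]addrC subrKA.
have orth w := (PP w).2 d dV.
by rewrite {1}dE mipDl mipNl mipDl mipZl !orth mulr0 !add0r oppr0.
Qed.

(** The weight [M1] cancels [invmx M1], and the two remaining scalars are 1-by-1 matrices transposed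
    to one another. *)
Lemma mip_Qh_skew (R : realType) (n1 n2 : nat) (D1 : 'M[R]_(n2, n1))
    (M1 : 'M[R]_n1) (U : 'cV[R]_n1 -> 'M[R]_(n1, n2)) (v1 v2 : 'cV[R]_n1) :
  pos_diag M1 -> mip M1 (Qh D1 M1 U v1 v2) v2 = 0.
Proof.
move=> pM; rewrite mipC; last by case: pM.
rewrite /mip /Qh -mulmxA mulKVmx ?pos_diag_unitmx//.
rewrite -scalemxAr mulmxBr mxE [X in _ * X]mxE [X in _ + X]mxE.
suff -> : v2^T *m (D1^T *m (U v1)^T *m v2) = (v2^T *m (U v1 *m D1 *m v2))^T.
  by rewrite [X in _ - X]mxE subrr mulr0.
by rewrite !trmx_mul trmxK mulmxA.
Qed.

Lemma mip_Delta_h (R : realType) (n1 n2 : nat) (D1 : 'M[R]_(n2, n1))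
    (M1 : 'M[R]_n1) (M2 : 'M[R]_n2) (v : 'cV[R]_n1) :
  pos_diag M1 ->
  mip M1 (Delta_h D1 M1 M2 *m v) v = mip M2 (D1 *m v) (D1 *m v).
Proof.
move=> pM; rewrite mipC; last by case: pM.
rewrite /mip /Delta_h -!mulmxA (mulmxA M1) mulmxV ?pos_diag_unitmx// mul1mx.
by rewrite trmx_mul !mulmxA.
Qed.

Lemma Delta_h_in_Vh (R : realType) (n1 n2 n3 : nat) (D1 : 'M[R]_(n2, n1))
    (D2 : 'M[R]_(n3, n1)) (M1 : 'M[R]_n1) (M2 : 'M[R]_n2) (v : 'cV[R]_n1) :
  D2 *m D1^T = 0 -> pos_diag M1 -> in_Vh D2 M1 (Delta_h D1 M1 M2 *m v).
Proof.
move=> DD pM; rewrite /in_Vh /Delta_h -!mulmxA (mulmxA M1) mulmxV ?pos_diag_unitmx//.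
by rewrite mul1mx mulmxA DD mul0mx.
Qed.

(** * Calculus along trajectories and Gronwall's inequality *)

Lemma is_derive_mip (R : realType) (n : nat) (M : 'M[R]_n) (u : R -> 'cV[R]_n)
    (t : R) (d : 'cV[R]_n) : is_diag_mx M -> is_derive t 1 u d ->
  is_derive t 1 (fun s => mip M (u s) (u s)) (2 * mip M d (u t)).
Proof.
move=> dM ud.
have -> : (fun s => mip M (u s) (u s)) =
    \sum_(i < n) (M i i *: ((fun s => u s i 0) * (fun s => u s i 0))).
  apply/funext => s; rewrite mip_diag// fct_sumE.
  by apply: eq_bigr => i _; rewrite !fctE.
rewrite mip_diag// mulr_sumr.
apply: is_derive_sum => i.
have di := is_derive_coord _ _ u t d i ud.
apply: is_derive_eq.
by rewrite /GRing.scale/=; ring.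
Qed.

Lemma quadratic_continuous (R : realType) (n : nat) (W : normedModType R)
    (B : 'cV[R]_n -> 'cV[R]_n -> W) (A : 'cV[R]_n -> W) :
  (forall (a : R) x x' y, B (a *: x + x') y = a *: B x y + B x' y) ->
  (forall (a : R) x y y', B x (a *: y + y') = a *: B x y + B x y') ->
  (forall (a : R) x y, A (a *: x + y) = a *: A x + A y) ->
  continuous (fun x => B x x + A x).
Proof.
move=> B1 B2 lA x.
(* With radius [|x| + 1] the whole unit ball around [x] lies where the Lipschitz bound is valid. *)
have x1 : 0 <= `|x| + 1 by rewrite addr_ge0.
have [K [K0 KP]] := quadratic_lipschitz_on_ball _ _ _ B A _ x1 B1 B2 lA.
apply: (lipschitz_near_continuous _ _ _ _ K x K0) => y yx; apply: KP.
  by rewrite lerDl.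
by rewrite -[y](subKr x); apply: (le_trans (ler_normB _ _)); exact: lerD.
Qed.

Lemma mip_continuous (R : realType) (n : nat) (M : 'M[R]_n) :
  continuous (fun x : 'cV[R]_n => mip M x x).
Proof.
have -> : (fun x : 'cV[R]_n => mip M x x) = (fun x => mip M x x + (fun=> 0 : R) x).
  by apply/funext => x; rewrite addr0.
apply: quadratic_continuous => *.
- by rewrite mipDl mipZl.
- by rewrite mipDr mipZr.
- by rewrite scaler0 addr0.
Qed.

Lemma is_derive_mulmx (R : realType) (m n : nat) (A : 'M[R]_(m, n))
    (u : R -> 'cV[R]_n) (t : R) (d : 'cV[R]_n) :
  is_derive t 1 u d -> is_derive t 1 (fun s => A *m u s) (A *m d).
Proof.
move=> ud; apply: is_derive_cV => i.
rewrite (_ : (fun _ => _) = \sum_(j < n) (A i j *: (fun s => u s j 0))); last first.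
  by apply/funext => s; rewrite mxE fct_sumE; apply: eq_bigr => j _; rewrite !fctE.
rewrite mxE; apply: is_derive_sum => j.
by have dj := is_derive_coord _ _ u t d j ud; exact: is_deriveZ.
Qed.

(** Serves the constructed flow, which is differentiable from both sides at 0; the right limit there
    is a restriction of the punctured one. *)
Lemma has_deriv_Ici_two_sided (R : realType) (V : normedModType R)
    (f df : R -> V) :
  (forall t : R, 0 <= t -> is_derive t 1 f (df t)) -> has_deriv_Ici f df.
Proof.
move=> fd; split=> [t t0|]; first exact/fd/ltW.
have [d0 <-] := fd 0 (lexx _).
have : (fun h : R => h^-1 *: (f h - f 0)) @ 0^' --> 'D_1 f 0.
  move: d0; rewrite /derivable /derive.
  rewrite (_ : (fun h : R => h^-1 *: ((f \o shift 0) (h *: 1) - f 0)) =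
    (fun h : R => h^-1 *: (f h - f 0)))//.
  by apply/funext => h; rewrite /= addr0 /GRing.scale/= mulr1.
exact: cvg_dnbhs_at_right.
Qed.

Lemma within_continuous_ge0 (R : realType) (V : normedModType R) (f : R -> V) :
  (forall t : R, 0 <= t -> {for t, continuous f}) ->
  {within `[0, +oo[, continuous f}.
Proof.
move=> cf; apply: continuous_in_subspaceT => t; rewrite inE/= in_itv/= andbT.
exact: cf.
Qed.

Lemma gronwall_le0 (R : realType) (phi dphi : R -> R) (K T : R) : 0 <= T ->
  {within `[0, T], continuous phi} ->
  (forall t : R, 0 < t < T -> is_derive t 1 phi (dphi t)) ->
  (forall t : R, 0 < t < T -> dphi t <= K * phi t) ->
  phi 0 <= 0 -> phi T <= 0.
Proof.
move=> T0 cphi dphiP dphiK phi0.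
(* Integrating factor: [phi * e] has derivative [e * (dphi - K * phi) <= 0]. The leading 1 matches
   the shape of [is_derive_expR_scaled]. *)
pose e (t : R) := 1 * expR (- K * t).
have e0 t : 0 < e t by rewrite /e mul1r expR_gt0.
have de (t : R) : is_derive t 1 e (- K * e t) by exact: is_derive_expR_scaled.
have : (phi * e) T <= (phi * e) 0.
  apply: (@derive_le0_nonincreasing _ _
      (fun t => phi t *: (- K * e t) + e t *: dphi t)) => //.
  - have ce : {within `[0, T], continuous e}.
      by apply: continuous_subspaceT => t; exact: is_derive_continuous (de t).
    by move=> t; apply: continuousM; [exact: cphi|exact: ce].
  - by move=> t /dphiP dt; exact: is_deriveM.
  - move=> t /dphiK h; rewrite /GRing.scale/=; have := e0 t; nra.
rewrite !fctE {2}/e mulr0 expR0 !mulr1 => h.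
by have := le_trans h phi0; rewrite pmulr_lle0.
Qed.

(** Since [v] lies in [V_h], pairing with it does not distinguish [P (Qh v v)] from [Qh v v], whose
    pairing vanishes by skewness; only viscosity is left. *)
Lemma mip_field (R : realType) (n1 n2 n3 : nat)
    (D1 : 'M[R]_(n2, n1)) (D2 : 'M[R]_(n3, n1)) (M1 : 'M[R]_n1) (M2 : 'M[R]_n2)
    (U : 'cV[R]_n1 -> 'M[R]_(n1, n2)) (P : 'cV[R]_n1 -> 'cV[R]_n1) (nu : R)
    (v : 'cV[R]_n1) :
  pos_diag M1 -> is_M1_proj D2 M1 P -> in_Vh D2 M1 v ->
  mip M1 (- P (Qh D1 M1 U v v) - nu *: (Delta_h D1 M1 M2 *m v)) v =
    - nu * mip M2 (D1 *m v) (D1 *m v).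
Proof.
move=> pM PP vV; have [_ /(_ v vV)] := PP (Qh D1 M1 U v v).
rewrite mipDl mipNl mip_Qh_skew// add0r => /eqP; rewrite oppr_eq0 => /eqP PQ.
by rewrite mipDl !mipNl PQ oppr0 add0r mipZl mip_Delta_h// mulNr.
Qed.

(** Stated for an arbitrary solution, since uniqueness must also confine the competitor to the ball
    where the field is Lipschitz. *)
Lemma C1_sol_energy_le (R : realType) (n1 n3 : nat) (D2 : 'M[R]_(n3, n1))
    (M1 : 'M[R]_n1) (F : 'cV[R]_n1 -> 'cV[R]_n1) (v0 : 'cV[R]_n1)
    (w : R -> 'cV[R]_n1) (t : R) :
  is_diag_mx M1 ->
  (forall x, in_Vh D2 M1 x -> mip M1 (F x) x <= 0) ->
  is_C1_sol D2 M1 F v0 w -> 0 <= t -> mip M1 (w t) (w t) <= mip M1 v0 v0.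
Proof.
move=> dM F0 [w0 wV cw [dw _] _] t0; rewrite -w0.
apply: (derive_le0_nonincreasing _ (fun s => mip M1 (w s) (w s))
  (fun s => 2 * mip M1 (F (w s)) (w s))) => //.
- have cwt : {within `[0, t], continuous w}.
    by apply: continuous_subspaceW cw => s/=; rewrite !in_itv/= => /andP[->].
  move=> s; apply: (@continuous_comp (subspace `[0, t]) _ _ w (fun x => mip M1 x x)).
    exact: cwt.
  exact: mip_continuous.
- by move=> s /andP[s0 _]; apply: is_derive_mip => //; exact: dw.
- by move=> s /andP[/ltW s0 _]; rewrite pmulr_rle0//; exact/F0/wV.
Qed.

Lemma C1_sol_unique (R : realType) (n1 n3 : nat) (D2 : 'M[R]_(n3, n1))
    (M1 : 'M[R]_n1) (F : 'cV[R]_n1 -> 'cV[R]_n1) (v0 : 'cV[R]_n1)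
    (K r : R) (v w : R -> 'cV[R]_n1) (t : R) :
  pos_diag M1 -> 0 <= K ->
  (forall x y, `|x| <= r -> `|y| <= r -> `|F x - F y| <= K * `|x - y|) ->
  (forall s : R, 0 <= s -> `|v s| <= r) -> (forall s : R, 0 <= s -> `|w s| <= r) ->
  is_C1_sol D2 M1 F v0 v -> is_C1_sol D2 M1 F v0 w -> 0 <= t -> w t = v t.
Proof.
move=> pM K0 FK vr wr [v00 _ cv [dv _] _] [w00 _ cw [dw _] _] t0.
have dM : is_diag_mx M1 by case: pM.
have [c [c0 cP]] := mip_norm_equiv _ _ M1 pM.
have [b [b0 bP]] : exists b, 0 <= b /\ forall x y, `|mip M1 x y : R| <= b * `|x| * `|y|.
  by apply: bilinear_bound => *; [rewrite mipDl mipZl|rewrite mipDr mipZr].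
apply/eqP; rewrite -subr_eq0; apply/eqP; apply: (mip_eq0 _ _ M1 _ pM).
have sub0t : [set` `[0, t]] `<=` [set` `[0, +oo[].
  by move=> s/=; rewrite !in_itv/= => /andP[->].
have cwt := continuous_subspaceW sub0t cw.
have cvt := continuous_subspaceW sub0t cv.
(* In the rate, [b] bounds the bilinear form, [K] is the Lipschitz constant, [c] turns the squared
   sup norm back into energy, and 2 comes from differentiating a square. *)
apply: (gronwall_le0 _ (fun s => mip M1 ((w - v) s) ((w - v) s))
  (fun s => 2 * mip M1 (F (w s) - F (v s)) ((w - v) s)) (2 * (b * K * c)) t t0).
- move=> s; apply: (@continuous_comp (subspace `[0, t]) _ _ (w - v) (fun x => mip M1 x x)).
    exact: (continuousB (cwt s) (cvt s)).
  exact: mip_continuous.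
- move=> s /andP[s0 _]; apply: is_derive_mip => //.
  by have := dw s s0; have := dv s s0 => ? ?; exact: is_deriveB.
- move=> s /andP[/ltW s0 _]; rewrite -!mulrA ler_pM2l// !fctE.
  set d := w s - v s.
  apply: (le_trans (ler_norm _)); apply: (le_trans (bP _ _)).
  rewrite -mulrA ler_wpM2l//.
  apply: (@le_trans _ _ (K * `|d| * `|d|)).
    by rewrite ler_wpM2r//; apply: FK; [exact: wr|exact: vr].
  by rewrite -mulrA -expr2 ler_wpM2l// cP.
- by rewrite !fctE v00 w00 subrr /mip mulmx0 mxE.
Qed.

(* The field is cut off by [radial]. Since [radial r x] is a positive multiple
   of [x], the truncated flow still dissipates the energy, hence never leaves the
   ball where the truncation is inactive. *)
Lemma dissipative_ode_global_solution (R : realType) (n1 n3 : nat)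
    (D2 : 'M[R]_(n3, n1)) (M1 : 'M[R]_n1) (F : 'cV[R]_n1 -> 'cV[R]_n1)
    (v0 : 'cV[R]_n1) (K r : R) :
  pos_diag M1 -> 0 < K -> 0 < r ->
  (forall x, mip M1 x x <= mip M1 v0 v0 -> `|x| <= r) ->
  (forall x y, `|x| <= r -> `|y| <= r -> `|F x - F y| <= K * `|x - y|) ->
  (forall x, in_Vh D2 M1 (F x)) ->
  (forall x, in_Vh D2 M1 x -> mip M1 (F x) x <= 0) ->
  in_Vh D2 M1 v0 ->
  exists v : R -> 'cV[R]_n1, [/\ v 0 = v0,
    (forall t : R, 0 <= t -> in_Vh D2 M1 (v t)) &
    forall t : R, 0 <= t -> is_derive t 1 v (F (v t))].
Proof.
move=> pM K0 r0 Er FK FV F0 v0V; have dM : is_diag_mx M1 by case: pM.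
pose G x := F (radial r x).
have GL x y : `|G x - G y| <= K * 2 * `|x - y|.
  apply: (le_trans (FK _ _ _ _)); [exact: radial_norm|exact: radial_norm|].
  by rewrite -mulrA ler_pM2l// radial_lipschitz.
have [v [v00 dv]] :=
  lipschitz_ode_global_solution _ _ G (K * 2) v0 (mulr_gt0 K0 (ltr0Sn _ 1)) GL.
(* The field takes values in [V_h], so [D2 *m M1 *m v] has zero derivative; the mean value
   inequality with majorant 0 keeps it at its initial value 0. *)
have vV t : 0 <= t -> in_Vh D2 M1 (v t).
  move=> t0; have := derive_mean_value_le _ _ (fun s => D2 *m M1 *m v s)
    (fun s => D2 *m M1 *m G (v s)) (cst 0) (cst 0) t t0
    (fun s s0 => is_derive_mulmx _ _ _ _ v s _ (dv s s0))
    (fun s _ => is_derive_cst _ s 1).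
  rewrite v00 (v0V : D2 *m M1 *m v0 = 0) !subr0 normr_le0 => H.
  by apply/eqP/H => s s0; rewrite (FV _ : D2 *m M1 *m G _ = 0) normr0.
have vE t : 0 <= t -> mip M1 (v t) (v t) <= mip M1 v0 v0.
  move=> t0; rewrite -v00.
  apply: (derive_le0_nonincreasing _ (fun s => mip M1 (v s) (v s))
    (fun s => 2 * mip M1 (G (v s)) (v s))) => //.
  - apply: continuous_in_subspaceT => s; rewrite inE/= in_itv/= => /andP[s0 _].
    exact: is_derive_continuous (is_derive_mip _ _ M1 v s _ dM (dv s s0)).
  - by move=> s /andP[/ltW s0 _]; apply: is_derive_mip => //; exact: dv.
  - move=> s /andP[/ltW s0 _]; rewrite pmulr_rle0//.
    have := F0 (radial r (v s)); rewrite {3}/radial mipZr pmulr_rle0 ?radial_factor_gt0//.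
    apply; rewrite -[radial r _]addr0; apply: in_Vh_linear; first exact: vV.
    by rewrite /in_Vh mulmx0.
exists v; split=> // t t0; have := dv t t0.
by rewrite /G radial_id//; exact/Er/vE.
Qed.

(** * Bilinearity of [Qh], written as one matrix applied to its second argument *)

Lemma QhE (R : realType) (n1 n2 : nat) (D1 : 'M[R]_(n2, n1)) (M1 : 'M[R]_n1)
    (U : 'cV[R]_n1 -> 'M[R]_(n1, n2)) (v1 v2 : 'cV[R]_n1) :
  Qh D1 M1 U v1 v2 =
    invmx M1 *m (2^-1 *: (U v1 *m D1 - D1^T *m (U v1)^T)) *m v2.
Proof. by rewrite /Qh -[RHS]mulmxA -scalemxAl mulmxBl. Qed.

Lemma Qh_linear_l (R : realType) (n1 n2 : nat) (D1 : 'M[R]_(n2, n1))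
    (M1 : 'M[R]_n1) (U : 'cV[R]_n1 -> 'M[R]_(n1, n2)) (a : R)
    (x x' y : 'cV[R]_n1) :
  (forall (a : R) x y, U (a *: x + y) = a *: U x + U y) ->
  Qh D1 M1 U (a *: x + x') y = a *: Qh D1 M1 U x y + Qh D1 M1 U x' y.
Proof.
move=> lU; rewrite !QhE lU linearP/= mulmxDl mulmxDr -scalemxAl -(scalemxAr a).
rewrite opprD addrACA -scalerBr scalerDr scalerA [2^-1 * a]mulrC -scalerA.
by rewrite mulmxDr -scalemxAr mulmxDl -scalemxAl.
Qed.

Lemma Qh_linear_r (R : realType) (n1 n2 : nat) (D1 : 'M[R]_(n2, n1))
    (M1 : 'M[R]_n1) (U : 'cV[R]_n1 -> 'M[R]_(n1, n2)) (a : R)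
    (x y y' : 'cV[R]_n1) :
  Qh D1 M1 U x (a *: y + y') = a *: Qh D1 M1 U x y + Qh D1 M1 U x y'.
Proof. by rewrite !QhE mulmxDr -scalemxAr. Qed.

(** * Well-posedness and energy balance of the projected equation *)

Theorem theorem4p8 (R : realType) (n1 n2 n3 : nat)
  (D1 : 'M[R]_(n2, n1)) (D2 : 'M[R]_(n3, n1))
  (M1 : 'M[R]_n1) (M2 : 'M[R]_n2)
  (U : 'cV[R]_n1 -> 'M[R]_(n1, n2)) (P : 'cV[R]_n1 -> 'cV[R]_n1)
  (nu : R) (v0 : 'cV[R]_n1) :
  D2 *m D1^T = 0 ->
  pos_diag M1 -> pos_diag M2 ->
  (forall (a : R) (x y : 'cV[R]_n1), U (a *: x + y) = a *: U x + U y) ->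
  is_M1_proj D2 M1 P ->
  0 <= nu ->
  in_Vh D2 M1 v0 ->
  let F := fun v => - P (Qh D1 M1 U v v) - nu *: (Delta_h D1 M1 M2 *m v) in
  exists v : R -> 'cV[R]_n1,
    [/\ is_C1_sol D2 M1 F v0 v,
        (forall w, is_C1_sol D2 M1 F v0 w -> forall t, 0 <= t -> w t = v t),
        has_deriv_Ici (Ekin M1 v)
          (fun t => - nu * mip M2 (D1 *m v t) (D1 *m v t))
        /\ (forall t, 0 <= t -> - nu * mip M2 (D1 *m v t) (D1 *m v t) <= 0),
        (forall t, 0 <= t -> Ekin M1 v t <= Ekin M1 v 0) &
        (forall T, 0 < T ->
           nu * Rintegral lebesgue_measure `[0, T]
                  (fun t => mip M2 (D1 *m v t) (D1 *m v t))
           <= Ekin M1 v 0)].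
Proof.
move=> DD pM1 pM2 lU PP nu0 v0V F.
have dM1 : is_diag_mx M1 by case: pM1.
(* [F x] is [B x x + A x] by conversion, so the quadratic estimates apply to [F] directly. *)
pose B x y := - P (Qh D1 M1 U x y).
pose A (x : 'cV[R]_n1) := - (nu *: (Delta_h D1 M1 M2 *m x)).
have lP := M1_proj_linear _ _ _ _ _ _ pM1 PP.
have B1 (a : R) x x' y : B (a *: x + x') y = a *: B x y + B x' y.
  by rewrite /B Qh_linear_l// lP opprD scalerN.
have B2 (a : R) x y y' : B x (a *: y + y') = a *: B x y + B x y'.
  by rewrite /B Qh_linear_r lP opprD scalerN.
have lA (a : R) x y : A (a *: x + y) = a *: A x + A y.
  by rewrite /A mulmxDr -scalemxAr scalerDr opprD scalerA [nu * a]mulrC -scalerA scalerN.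
(* The ball contains the energy sublevel set of [v0], which no solution leaves. *)
have [r [r0 rP]] := mip_bounded _ _ M1 (mip M1 v0 v0) pM1.
have [K [K0 FK]] := quadratic_lipschitz_on_ball _ _ _ B A r (ltW r0) B1 B2 lA.
have cF : continuous F := quadratic_continuous _ _ _ B A B1 B2 lA.
have FV x : in_Vh D2 M1 (F x).
  rewrite /F addrC -scaleNr; apply: in_Vh_linear; first exact: Delta_h_in_Vh.
  rewrite -scaleN1r -[X in in_Vh _ _ X]addr0; apply: in_Vh_linear.
    by have [] := PP (Qh D1 M1 U x x).
  by rewrite /in_Vh mulmx0.
have FE x : in_Vh D2 M1 x -> mip M1 (F x) x = - nu * mip M2 (D1 *m x) (D1 *m x).
  exact: mip_field.
have dissip x : - nu * mip M2 (D1 *m x) (D1 *m x) <= 0.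
  by rewrite mulNr oppr_le0 mulr_ge0// mip_ge0.
have F0 x : in_Vh D2 M1 x -> mip M1 (F x) x <= 0 by move=> /FE ->.
have [v [v00 vV dv]] := dissipative_ode_global_solution _ _ _ D2 M1 F v0 K r
  pM1 K0 r0 rP FK FV F0 v0V.
have cv t : 0 <= t -> {for t, continuous v}.
  by move=> t0; exact: is_derive_continuous (dv t t0).
have solv : is_C1_sol D2 M1 F v0 v.
  split=> //.
  - exact: within_continuous_ge0.
  - exact: has_deriv_Ici_two_sided.
  - apply: within_continuous_ge0 => t t0.
    by apply: (@continuous_comp _ _ _ v F); [exact: cv|exact: cF].
have sol_le w : is_C1_sol D2 M1 F v0 w -> forall s : R, 0 <= s -> `|w s| <= r.
  by move=> ws s s0; apply: rP; exact: C1_sol_energy_le ws s0.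
have dE (t : R) : 0 <= t ->
    is_derive t 1 (Ekin M1 v) (- nu * mip M2 (D1 *m v t) (D1 *m v t)).
  move=> t0; rewrite -FE; last exact: vV.
  have := is_deriveZ 2^-1 (is_derive_mip _ _ M1 v t _ dM1 (dv t t0)).
  by rewrite /GRing.scale/= mulKf.
have E0 t : 0 <= Ekin M1 v t by rewrite mulr_ge0// mip_ge0.
exists v; split=> //.
- move=> w ws t t0.
  exact: (C1_sol_unique _ _ _ _ _ _ _ _ _ _ _ _ pM1 (ltW K0) FK
    (sol_le v solv) (sol_le w ws) solv ws t0).
- split=> //; exact: has_deriv_Ici_two_sided.
- move=> t t0; rewrite ler_pM2l// v00; exact: C1_sol_energy_le F0 solv t0.
- move=> T T0.
  pose g (t : R) := mip M2 (D1 *m v t) (D1 *m v t).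
  have cg : {within `[0, T], continuous g}.
    apply: continuous_in_subspaceT => t; rewrite inE/= in_itv/= => /andP[t0 _].
    apply: (@continuous_comp _ _ _ (fun s => D1 *m v s) (fun x => mip M2 x x)).
      exact: is_derive_continuous (is_derive_mulmx _ _ _ _ v t _ (dv t t0)).
    exact: mip_continuous.
  (* Integrability of [g] allows the factor [- nu] to be pulled out of the integral below. *)
  have intg : lebesgue_measure.-integrable `[0, T] (EFin \o g).
    by apply: continuous_compact_integrable => //; exact: segment_compact.
  have cE (t : R) : 0 <= t -> {for t, continuous (Ekin M1 v)}.
    by move=> t0; exact: is_derive_continuous (dE t t0).
  (* The factor [- nu] stays inside so that the integrand is the derivative of the energy; the bound
     then follows from [Ekin M1 v T >= 0]. *)
  have : (\int[lebesgue_measure]_(t in `[0, T]) (- nu * g t))%R =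
      Ekin M1 v T - Ekin M1 v 0.
    rewrite /Rintegral (@continuous_FTC2 _ _ (Ekin M1 v))//.
    + move=> t; apply: (@continuousM R (subspace `[0, T]) (cst (- nu)) g).
        exact: cst_continuous.
      exact: cg.
    + split.
      * by move=> t; rewrite in_itv/= => /andP[/ltW /dE []].
      * exact/cvg_at_right_filter/cE.
      * exact/cvg_at_left_filter/cE/ltW.
    + by move=> t; rewrite in_itv/= => /andP[/ltW /dE [_ <-] _]; rewrite derive1E.
  rewrite RintegralZl// => H.
  by have := E0 T; rewrite -/g; move: H; rewrite mulNr; lra.
Qed.
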